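(* The map $$v\colon Fl(n)\times Mat_n \to B^-_{2n}\backslash GL_{2n}/B_{2n}\cong S_{2n},\qquad (gB/B,\,X)\mapsto B^-_{2n}\begin{bmatrix} X & g\\ w_0g^{-1} & 0\end{bmatrix}B_{2n}$$ is well-defined (independent of the choice of lift of $gB/B\in GL_n/B\cong Fl(n)$ to $g\in GL_n$). Moreover, for $(F^\bullet,X)\in Fl(n)\times Mat_n$, the value $v(F^\bullet,X)$ both determines and is determined by the following $4n^2$ statistics: (a) $\mathrm{rank}\big(E^i\hookrightarrow \mathbb{A}^n\xrightarrow{X}\mathbb{A}^n\twoheadrightarrow \mathbb{A}^n/E_j\big)$, for $i\in\{1,\dots,n\}$, $j\in\{0,\dots,n-1\}$; (b) $\mathrm{rank}\big(\mathbb{A}^n\xrightarrow{X}\mathbb{A}^n\twoheadrightarrow \mathbb{A}^n/(E_{n-i}+F^j)\big)-\dim(E_{n-i}\cap F^j)$, for $i,j\in\{1,\dots,n\}$; (c) $\mathrm{rank}\big(F^{n-i}\cap E^j\hookrightarrow\mathbb{A}^n\xrightarrow{X}\mathbb{A}^n\big)-\dim(E^j\cap F^{n-i})$, for $i,j\in\{1,\dots,n\}$; (d) $\mathrm{rank}\big(F^i\hookrightarrow\mathbb{A}^n\xrightarrow{X}\mathbb{A}^n\twoheadrightarrow\mathbb{A}^n/F^j\big)$, for $i,j\in\{1,\dots,n\}$. That is, two points of $Fl(n)\times Mat_n$ have the same image under $v$ if and only if all of these statistics agree for the two points.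
   Context: $B=B_n\le GL_n$ and $B^-=B_n^-\le GL_n$ are the subgroups of upper, respectively lower, triangular invertible matrices; similarly $B_{2n},B^-_{2n}\le GL_{2n}$. $Mat_n$ is the space of $n\times n$ matrices. $Fl(n)$ is the variety of full flags $F^\bullet=(0=F^0\subset F^1\subset\dots\subset F^n=\mathbb{A}^n)$ with $\dim F^j=j$, identified with $GL_n/B$ by sending $gB/B$ to the flag with $F^j$ the span of the first $j$ columns of $g$. $E^i$ is the span of the first $i$ standard basis vectors of $\mathbb{A}^n$ (the standard flag, $B$-invariant), and $E_i$ is the span of the last $i$ standard basis vectors (the anti-standard flag, $B^-$-invariant); $E_0=0$. $w_0$ is the $n\times n$ permutation matrix with $1$s on the antidiagonal. The identification $B^-_{2n}\backslash GL_{2n}/B_{2n}\cong S_{2n}$ is the Bruhat decomposition: every double coset contains a unique permutation matrix, where $\sigma\in S_{2n}$ corresponds to the matrix with $1$s in positions $(i,\sigma(i))$. *)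

(* Defs.v *)
From HB Require Import structures.
From mathcomp Require Import all_boot all_order all_algebra all_fingroup.
From mathcomp Require Import boolp classical_sets.

Set Implicit Arguments.
Unset Strict Implicit.
Unset Printing Implicit Defensive.

Import GRing.Theory.
Local Open Scope ring_scope.

Section LinearMaps.
Variables (K : fieldType) (V V' : vectType K).

Definition lrank (f : 'Hom(V, V')) : nat := \dim (limg f).

Definition incl (U : {vspace V}) : 'Hom(subvs_of U, V) := linfun vsval.

(* The quotient space V / W is modelled by the complement W^C of W; the two
   lemmas after quot_proj show that this map has the defining properties of
   the projection V ->> V / W. *)
Definition quot (W : {vspace V}) : vectType K := subvs_of (W^C)%VS.

Definition quot_proj (W : {vspace V}) : 'Hom(V, quot W) :=
  (linfun (vsproj (W^C)%VS) \o daddv_pi (W^C)%VS W)%VF.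

Lemma quot_projE (W : {vspace V}) (u : V) :
  vsval (quot_proj W u) = daddv_pi (W^C)%VS W u.
Proof. by rewrite comp_lfunE lfunE /= vsprojK // memv_pi. Qed.

Lemma lker_quot_proj (W : {vspace V}) : lker (quot_proj W) = W.
Proof.
have cap0 : (W^C :&: W = 0)%VS by rewrite capvC capv_compl.
have decomp u : daddv_pi (W^C)%VS W u + daddv_pi W (W^C)%VS u = u.
  by rewrite daddv_pi_add // addvC addv_complf memvf.
apply/vspaceP => u; rewrite memv_ker -val_eqE /= quot_projE.
apply/eqP/idP => [u0|uW].
  by rewrite -(decomp u) u0 add0r memv_pi.
have /addIr : daddv_pi (W^C)%VS W u + u = 0 + u.
  by rewrite -[X in _ + X](daddv_pi_id (capv_compl W) uW) decomp add0r.
by [].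
Qed.

Lemma limg_quot_proj (W : {vspace V}) : limg (quot_proj W) = fullv.
Proof.
have cap0 : (W^C :&: W = 0)%VS by rewrite capvC capv_compl.
apply/vspaceP => u; rewrite memvf; apply/memv_imgP; exists (vsval u).
  exact: memvf.
by apply: val_inj; rewrite /= quot_projE daddv_pi_id // subvsP.
Qed.

End LinearMaps.

Section Flags.
Variables (K : fieldType) (n : nat).
Local Notation A := 'cV[K]_n.

Record flag := Flag {
  flag_space : {ffun 'I_n.+1 -> {vspace A}};
  flag_dim : forall j, \dim (flag_space j) = j;
  flag_sub : forall i j : 'I_n.+1, (i <= j)%N ->
    (flag_space i <= flag_space j)%VS }.

(* F^j; only meaningful for j <= n *)
Definition flag_at (F : flag) (j : nat) : {vspace A} := flag_space F (inord j).

Definition col_span (g : 'M[K]_n) (j : nat) : {vspace A} :=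
  (\sum_(k < n | (k < j)%N) <[col k g]>)%VS.

(* The coset gB corresponds to the flag F under GL_n / B = Fl(n). *)
Definition is_lift (F : flag) (g : 'M[K]_n) : Prop :=
  g \in unitmx /\ forall j, (j <= n)%N -> flag_at F j = col_span g j.

(* E^i and E_i; the truncated subtraction is harmless as only i <= n matters *)
Definition std_flag (i : nat) : {vspace A} :=
  (\sum_(k < n | (k < i)%N) <[delta_mx k 0%R]>)%VS.
Definition anti_flag (i : nat) : {vspace A} :=
  (\sum_(k < n | (n - i <= k)%N) <[delta_mx k 0%R]>)%VS.

Lemma is_lift_exists (F : flag) : exists g, is_lift F g.
Proof.
have dimF j : (j <= n)%N -> \dim (flag_at F j) = j.
  by move=> jn; rewrite flag_dim inordK.
pose w (k : nat) : A := vpick (flag_at F k.+1 :\: flag_at F k)%VS.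
have wP k : (k < n)%N -> (flag_at F k + <[w k]> = flag_at F k.+1)%VS.
  move=> kn.
  have dk : \dim (flag_at F k) = k by apply: dimF; apply: ltnW.
  have dk1 : \dim (flag_at F k.+1) = k.+1 by apply: dimF.
  have w0 : w k != 0.
    rewrite vpick0 diffv_eq0; apply/negP => /dimvS.
    by rewrite dk dk1 ltnn.
  have wd : w k \in (flag_at F k.+1 :\: flag_at F k)%VS by exact: memv_pick.
  have sub : (flag_at F k <= flag_at F k.+1)%VS.
    by apply: flag_sub; rewrite !inordK ?ltnS // ltnW.
  have wF : w k \in flag_at F k.+1.
    by apply: (subvP (diffvSl _ (flag_at F k))); apply: wd.
  apply/eqP; rewrite eqEdim subv_add sub -memvE wF /=.
  rewrite dk1 dimv_disjoint_sum ?dk ?dim_vline ?w0 ?addn1 //.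
  apply/eqP; rewrite -subv0 -(capv_diff (flag_at F k.+1) (flag_at F k)).
  by rewrite capvC capvS // -memvE.
pose g : 'M[K]_n := \matrix_(i, j) w j i 0.
have colg k : col k g = w k by apply/colP => i; rewrite !mxE.
have spanF j : (j <= n)%N -> flag_at F j = col_span g j.
  elim: j => [_|j IHj jn].
    rewrite /col_span big_pred0 //; apply/eqP.
    by rewrite -dimv_eq0 dimF.
  rewrite -wP // IHj 1?ltnW // /col_span.
  rewrite [RHS](bigD1 (Ordinal jn)) //= addvC colg; congr (_ + _)%VS.
  apply: eq_bigl => k; rewrite ltnS -val_eqE /=.
  by rewrite andbC -ltn_neqAle.
exists g; split => //.
have full u : exists c : 'cV_n, u = g *m c.
  have : u \in col_span g n.
    rewrite -spanF // (_ : flag_at F n = fullv) ?memvf //.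
    apply/eqP; rewrite eqEdim subvf dimF // dimvf dim_matrix.
    exact: eq_leq (muln1 n).
  case/memv_sumP => v vP ->.
  have vE k : exists a, v k = a *: col k g by apply/vlineP/vP.
  have [a aE] := choice vE.
  exists (\col_k a k); apply/colP => i; rewrite summxE !mxE.
  apply: eq_big => [k|k _]; first by rewrite ltn_ord.
  by rewrite aE !mxE mulrC.
have [c cE] := choice (fun k : 'I_n => full (delta_mx k 0)).
suff /mulmx1_unit[] : g *m (\matrix_(i, j) c j i 0) = 1%:M by [].
apply/matrixP => i j; have := congr1 (fun M : 'cV_n => M i 0) (cE j).
rewrite !mxE andbT => ->; apply: eq_bigr => k _; by rewrite !mxE.
Qed.

Definition flag_lift (F : flag) : 'M[K]_n := sval (cid (is_lift_exists F)).

End Flags.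

Section DoubleCosets.
Variables (K : fieldType) (m : nat).
Local Open Scope classical_set_scope.

(* is_trig_mx M means that M is lower triangular *)
Definition borel : set 'M[K]_m := [set b | b \in unitmx /\ is_trig_mx b^T].
Definition opp_borel : set 'M[K]_m := [set b | b \in unitmx /\ is_trig_mx b].

(* B^- M B *)
Definition dcoset (M : 'M[K]_m) : set 'M[K]_m :=
  [set N | exists b' b, [/\ opp_borel b', borel b & N = b' *m M *m b]].

(* perm_mx s has its 1s in positions (i, s i). The Bruhat decomposition says
   that the default value 1 is never used when D is a double coset in GL_m. *)
Definition bruhat_perm (D : set 'M[K]_m) : 'S_m :=
  xget 1%g [set s | D (perm_mx s)].

End DoubleCosets.

Section TheMap.
Variables (K : fieldType) (n : nat).

Definition w0 : 'M[K]_n := \matrix_(i, j) (j == rev_ord i)%:R.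

Definition vmx (g X : 'M[K]_n) : 'M[K]_(n + n) :=
  block_mx X g (w0 *m invmx g) 0.

Definition v_dcoset (F : flag K n) (X : 'M[K]_n) : set 'M[K]_(n + n) :=
  dcoset (vmx (flag_lift F) X).

Definition v (F : flag K n) (X : 'M[K]_n) : 'S_(n + n) :=
  bruhat_perm (v_dcoset F X).

Definition lmx (X : 'M[K]_n) : 'Hom('cV[K]_n, 'cV[K]_n) := linfun (mulmx X).

Local Notation E_up := (std_flag K n).
Local Notation E_dn := (anti_flag K n).

Definition stat_a (X : 'M[K]_n) (i j : nat) : nat :=
  lrank (quot_proj (E_dn j) \o (lmx X \o incl (E_up i)))%VF.

Definition stat_b (F : flag K n) (X : 'M[K]_n) (i j : nat) : int :=
  (lrank (quot_proj (E_dn (n - i) + flag_at F j)%VS \o lmx X)%VF)%:Z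
  - (\dim (E_dn (n - i) :&: flag_at F j)%VS)%:Z.

Definition stat_c (F : flag K n) (X : 'M[K]_n) (i j : nat) : int :=
  (lrank (lmx X \o incl (flag_at F (n - i) :&: E_up j)%VS)%VF)%:Z
  - (\dim (E_up j :&: flag_at F (n - i))%VS)%:Z.

Definition stat_d (F : flag K n) (X : 'M[K]_n) (i j : nat) : nat :=
  lrank (quot_proj (flag_at F j) \o (lmx X \o incl (flag_at F i)))%VF.

End TheMap.

(* Main.v *)
(* The ranks of the top left corners of a matrix are invariant under left
   multiplication by B^- and right multiplication by B, and on permutation
   matrices they separate points; so with the Bruhat decomposition they
   determine the double coset. For the matrix [X g; w0 g^-1 0] and a p x q
   corner, these ranks are (a)-(d) up to constants, according to whether p and
   q are at most n: the corner sends (u, c) with u in E^q and c in E^(q-n) to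
   the class of X u + g c modulo E_(n-p) together with the obstruction for u to
   lie in F^(2n-p), and g maps E^(q-n) onto F^(q-n). *)
Require Import Defs.
From HB Require Import structures.
From mathcomp Require Import all_boot all_order all_algebra all_fingroup.
From mathcomp Require Import boolp classical_sets.
From mathcomp Require Import zify.

Set Implicit Arguments.
Unset Strict Implicit.
Unset Printing Implicit Defensive.

Import GRing.Theory.
Local Open Scope ring_scope.

(** * Coordinate subspaces and their stability under triangular matrices *)

Section CoordinateSubspaces.
Variables (K : fieldType) (m : nat).
Implicit Types (P Q : pred 'I_m) (M b : 'M[K]_m) (u : 'cV[K]_m).

(** The sum has the same shape as in [std_flag] and [anti_flag], so that both are instances by
    conversion. *)
Definition coord_space P : {vspace 'cV[K]_m} :=
  (\sum_(k < m | P k) <[delta_mx k 0%R]>)%VS.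

Lemma coord_spaceP P u :
  reflect (forall k, ~~ P k -> u k 0 = 0) (u \in coord_space P).
Proof.
apply: (iffP memv_sumP) => [[w wP ->] k nPk|u0].
  rewrite summxE big1 // => l Pl; have /vlineP[a ->] := wP l Pl.
  rewrite !mxE andbT; case: eqP => [kl|_]; last by rewrite mulr0.
  by rewrite kl Pl in nPk.
exists (fun k => u k 0 *: delta_mx k 0) => [k _|].
  by apply: memvZ; apply: memv_line.
apply/colP => i; rewrite summxE.
have [Pi|nPi] := boolP (P i).
  rewrite (bigD1 i) //= big1 => [|l /andP[_ li]]; rewrite !mxE ?andbT.
    by rewrite eqxx mulr1 addr0.
  by rewrite eq_sym (negPf li) mulr0.
rewrite u0 // big1 // => l Pl; rewrite !mxE andbT.
case: eqP => [il|_]; last by rewrite mulr0.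
by rewrite il Pl in nPi.
Qed.

Lemma delta_coord_space P k : P k -> delta_mx k 0 \in coord_space P.
Proof. by move=> Pk; rewrite memvE; apply: (sumv_sup k). Qed.

Lemma dim_cV : \dim {:'cV[K]_m} = m.
Proof. by rewrite dimvf dim_matrix; exact: muln1. Qed.

(** The spaces for P and its complement have dimensions at most the two cardinalities and together
    span everything; as the cardinalities add up to m, both bounds are equalities. *)
Lemma dim_coord_space P : \dim (coord_space P) = #|P|.
Proof.
have ub Q : (\dim (coord_space Q) <= #|Q|)%N.
  apply: leq_trans (dimv_leq_sum _ _ _) _; rewrite -sum1_card.
  by apply: leq_sum => k _; rewrite dim_vline; case: eqP.
have full : (coord_space P + coord_space (predC P) = fullv)%VS.
  apply/vspaceP => u; rewrite memvf; apply/memv_addP.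
  exists (\col_k if P k then u k 0 else 0).
    by apply/coord_spaceP => k nP; rewrite mxE (negPf nP).
  exists (\col_k if P k then 0 else u k 0).
    by apply/coord_spaceP => k /negPn Pk; rewrite mxE Pk.
  by apply/colP => k; rewrite !mxE; case: ifP; rewrite ?addr0 ?add0r.
have := leq_of_leqif (dimv_add_leqif (coord_space P) (coord_space (predC P))).
rewrite full dim_cV => le_m.
apply/eqP; rewrite eqn_leq ub -(leq_add2r #|predC P|) cardC card_ord.
by apply: leq_trans le_m _; rewrite leq_add2l ub.
Qed.

Lemma lmxE M u : lmx M u = M *m u.
Proof. by rewrite lfunE. Qed.

Lemma lker0_lmx M : M \in unitmx -> lker (lmx M) = 0%VS.
Proof.
move=> Mu; apply/eqP/lker0P => x y; rewrite !lmxE => /(congr1 (mulmx (invmx M))).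
by rewrite !mulKmx.
Qed.

Lemma trig_coord_space b p u : is_trig_mx b ->
  u \in coord_space (fun k => p <= k)%N ->
  b *m u \in coord_space (fun k => p <= k)%N.
Proof.
move=> /is_trig_mxP bt /coord_spaceP u0; apply/coord_spaceP => k pk.
rewrite mxE big1 // => l _.
have [kl|lk] := ltnP k l; first by rewrite bt ?mul0r.
by rewrite u0 ?mulr0 //; lia.
Qed.

(** An injective map of a finite-dimensional space T into itself is onto T, so the inverse of b also
    preserves T. *)
Lemma trigV_coord_space b p u : b \in unitmx -> is_trig_mx b ->
  u \in coord_space (fun k => p <= k)%N ->
  invmx b *m u \in coord_space (fun k => p <= k)%N.
Proof.
move=> bu bt uT; set T := coord_space _.
have /eqP bT : (lmx b @: T == T)%VS.
  rewrite eqEdim limg_dim_eq ?leqnn ?andbT ?lker0_lmx ?capv0 //.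
  apply/subvP => _ /memv_imgP[w wT ->]; rewrite lmxE.
  exact: trig_coord_space.
have : u \in (lmx b @: T)%VS by rewrite bT.
by case/memv_imgP => w wT ->; rewrite lmxE mulKmx.
Qed.

End CoordinateSubspaces.

(** * The groups B and B^-, and double cosets as equivalence classes *)

Section BorelSubgroups.
Variables (K : fieldType) (m : nat).
Implicit Types (M N b c : 'M[K]_m).

Lemma opp_borel1 : opp_borel (1%:M : 'M[K]_m).
Proof. by split; [exact: unitmx1 | exact: scalar_mx_is_trig]. Qed.

Lemma opp_borelM b c : opp_borel b -> opp_borel c -> opp_borel (b *m c).
Proof.
move=> [bu bt] [cu ct]; split; first by rewrite unitmx_mul bu.
move/is_trig_mxP: bt => bt; move/is_trig_mxP: ct => ct.
apply/is_trig_mxP => i j ij; rewrite mxE big1 // => k _.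
have [ik|ki] := ltnP i k; first by rewrite bt ?mul0r.
by rewrite ct ?mulr0 //; apply: leq_ltn_trans ki ij.
Qed.

Lemma opp_borelV b : opp_borel b -> opp_borel (invmx b).
Proof.
move=> [bu bt]; split; first by rewrite unitmx_inv.
apply/is_trig_mxP => i j ij.
(* Column j of the inverse is the image of e_j, which lies in the span of the e_k with k >= j. *)
have /coord_spaceP/(_ i) :=
  trigV_coord_space bu bt (delta_coord_space K (leqnn j)).
rewrite -ltnNge => /(_ ij) <-; rewrite mxE (bigD1 j) //= mxE !eqxx mulr1.
by rewrite big1 ?addr0 // => l lj; rewrite mxE (negPf lj) mulr0.
Qed.

Lemma borel_tr b : borel b <-> opp_borel b^T.
Proof. by rewrite /borel /opp_borel /= unitmx_tr. Qed.

Lemma borel1 : borel (1%:M : 'M[K]_m).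
Proof. by apply/borel_tr; rewrite trmx1; exact: opp_borel1. Qed.

Lemma borelM b c : borel b -> borel c -> borel (b *m c).
Proof.
move=> /borel_tr bb /borel_tr cb; apply/borel_tr; rewrite trmx_mul.
exact: opp_borelM.
Qed.

Lemma borelV b : borel b -> borel (invmx b).
Proof.
by move=> /borel_tr bb; apply/borel_tr; rewrite trmx_inv; apply: opp_borelV.
Qed.

Lemma borel_entry b (k l : 'I_m) : borel b -> (l < k)%N -> b k l = 0.
Proof. by case=> _ /is_trig_mxP bt lk; have := bt _ _ lk; rewrite mxE. Qed.

Lemma dcoset_refl M : dcoset M M.
Proof.
exists 1%:M, 1%:M; rewrite mul1mx mulmx1.
by split; [exact: opp_borel1 | exact: borel1 |].
Qed.

Lemma dcoset_sym M N : dcoset M N -> dcoset N M.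
Proof.
move=> [b [c [bb cb ->]]]; exists (invmx b), (invmx c).
split; [exact: opp_borelV | exact: borelV |].
by rewrite -mulmxA mulmxK ?mulKmx //; [case: bb | case: cb].
Qed.

Lemma dcoset_trans M N L : dcoset M N -> dcoset N L -> dcoset M L.
Proof.
move=> [b [c [bb cb ->]]] [b' [c' [bb' cb' ->]]].
exists (b' *m b), (c *m c'); split; [exact: opp_borelM | exact: borelM |].
by rewrite !mulmxA.
Qed.

Lemma dcoset_eq M N : dcoset M N -> dcoset N = dcoset M.
Proof.
move=> MN; apply/seteqP; split => L /=; first exact: dcoset_trans MN.
by apply: dcoset_trans; apply: dcoset_sym.
Qed.

Lemma dcoset_unit M N : M \in unitmx -> dcoset M N -> N \in unitmx.
Proof. by move=> Mu [b [c [[bu _] [cu _] ->]]]; rewrite !unitmx_mul bu Mu cu. Qed.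

End BorelSubgroups.

(** * Corner ranks and the Bruhat decomposition *)

Section Bruhat.
Variables (K : fieldType) (m : nat).
Implicit Types (M N : 'M[K]_m) (s t : 'S_m).

(* For p, q <= m this is q minus the rank of the top left p x q block of M. *)
Definition corner_dim M (p q : nat) : nat :=
  \dim (coord_space K (fun k : 'I_m => k < q)%N
        :&: lmx M @^-1: coord_space K (fun k : 'I_m => p <= k)%N)%VS.

(** For N = b M c, multiplication by c embeds the space measured for N into the one for M: c
    preserves the span of the first q basis vectors, and M c w = b^-1 (N w), where b^-1 preserves
    the vectors vanishing in the first p coordinates. *)
Lemma corner_dim_le M N p q :
  dcoset M N -> (corner_dim N p q <= corner_dim M p q)%N.
Proof.
move=> [b [c [[bu bt] cb ->]]]; have [cu _] := cb.
rewrite /corner_dim -(@limg_dim_eq _ _ _ (lmx c)) ?lker0_lmx ?capv0 //.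
apply/dimvS/subvP => _ /memv_imgP[w wK ->].
move: wK; rewrite !memv_cap -!memv_preim !lmxE => /andP[wS wT].
apply/andP; split.
  move/coord_spaceP: wS => w0; apply/coord_spaceP => k; rewrite -leqNgt => qk.
  rewrite mxE big1 // => l _.
  have [lk|kl] := ltnP l k; first by rewrite (borel_entry cb) ?mul0r.
  by rewrite w0 ?mulr0 // -leqNgt; apply: leq_trans qk kl.
by have := trigV_coord_space bu bt wT; rewrite -!mulmxA mulKmx.
Qed.

Lemma corner_dim_dcoset M N p q :
  dcoset M N -> corner_dim N p q = corner_dim M p q.
Proof.
move=> MN; apply/eqP; rewrite eqn_leq corner_dim_le //=.
exact/corner_dim_le/dcoset_sym.
Qed.

(** This and [corner_dimp0] handle the empty corners, which correspond to none of the statistics. *)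
Lemma corner_dim0p M q : corner_dim M 0 q = #|fun k : 'I_m => (k < q)%N|.
Proof.
rewrite /corner_dim (_ : lmx M @^-1: _ = fullv)%VS ?capvf ?dim_coord_space //.
apply/vspaceP => u; rewrite -memv_preim memvf.
by apply/coord_spaceP => k; rewrite leq0n.
Qed.

Lemma corner_dimp0 M p : corner_dim M p 0 = 0%N.
Proof.
rewrite /corner_dim /coord_space big_pred0 => [|k]; last exact: ltn0.
by rewrite cap0v dimv0.
Qed.

Lemma perm_mx_mul s (w : 'cV[K]_m) k : (perm_mx s *m w) k 0 = w (s k) 0.
Proof. by rewrite -row_permE mxE. Qed.

Lemma corner_dim_perm s p q :
  corner_dim (perm_mx s) p q = #|[set i : 'I_m | (s i < q)%N && (p <= i)%N]|.
Proof.
(* The matrix of s sends e_k to e_(s^-1 k), so the space is spanned by the e_k with k in P;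
   reindexing along s^-1 gives the stated set of rows. *)
pose P : pred 'I_m := fun k => (k < q)%N && (p <= (s^-1)%g k)%N.
transitivity #|P|.
  rewrite -(dim_coord_space K P) /corner_dim; congr (\dim _).
  apply/vspaceP => u; rewrite memv_cap -memv_preim lmxE.
  apply/andP/coord_spaceP => [[/coord_spaceP uS /coord_spaceP uT] k|u0].
    rewrite negb_and => /orP[/uS //|/uT].
    by rewrite perm_mx_mul permKV.
  split; apply/coord_spaceP => k nk.
    by apply: u0; rewrite negb_and nk.
  by rewrite perm_mx_mul u0 // negb_and permK nk orbT.
rewrite -(card_preimset _ (@perm_inj _ (s^-1)%g)) -sum1_card -sum1_card.
by apply: eq_bigl => k; rewrite !inE permKV.
Qed.

(** Dropping row i from the count, that is, passing from p = i to p = i + 1, reveals whether s i <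
    q; knowing this for all q <= m determines s i. *)
Lemma corner_dim_perm_inj s t :
  (forall p q, (p <= m)%N -> (q <= m)%N ->
     corner_dim (perm_mx s) p q = corner_dim (perm_mx t) p q) -> s = t.
Proof.
move=> st; have lt_st i q : (q <= m)%N -> (s i < q)%N = (t i < q)%N.
  have step (r : 'S_m) :
      corner_dim (perm_mx r) i q = ((r i < q) + corner_dim (perm_mx r) i.+1 q)%N.
    rewrite !corner_dim_perm (cardsD1 i) inE leqnn andbT; congr (_ + _)%N.
    apply: eq_card => k; rewrite !inE [(i < k)%N]ltn_neqAle eq_sym -val_eqE /=.
    by rewrite andbCA.
  move=> qm; have := step s; rewrite !st ?ltn_ord ?(ltnW (ltn_ord i)) // step.
  by move/eqP; rewrite eqn_add2r; do 2 case: (_ < q)%N.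
apply/permP => i; apply: val_inj; apply/eqP; rewrite eqn_leq.
have := lt_st i (s i).+1; have := lt_st i (t i).+1; rewrite !ltnS !leqnn.
by move=> -> // <-.
Qed.

Lemma ord_lt_eqF (i j : 'I_m) : (i < j)%N -> (i == j) = false.
Proof. by move=> ij; rewrite -val_eqE ltn_eqF. Qed.

(* Gaussian elimination: the pivot of row k is its leftmost nonzero entry, used
   to clear the rest of its row rightwards and of its column downwards; the
   first k rows and their pivot columns are left unchanged. *)
Lemma bruhat_elim M k : M \in unitmx -> (k <= m)%N ->
  exists2 N, dcoset M N & forall i : 'I_m, (i < k)%N -> exists j,
    (forall l, N i l = (l == j)%:R) /\ (forall l, N l j = (l == i)%:R).
Proof.
move=> Mu; elim: k => [_|k IHk km]; first by exists M => //; exact: dcoset_refl.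
have [N MN piv] := IHk (ltnW km).
have Nu := dcoset_unit Mu MN.
pose r := Ordinal km.
have [j0 Nj0] : exists j, N r j != 0.
  apply/existsP; apply: contraLR Nu; rewrite negb_exists => /forallP N0.
  rewrite unitmxE (expand_det_row N r) big1 ?unitr0 // => j _.
  by have /negPn/eqP-> := N0 j; rewrite mul0r.
pose j : 'I_m := [arg min_(j < j0 | N r j != 0) (j : nat)].
have [jP jmin] : N r j != 0 /\ forall l, N r l != 0 -> (j <= l)%N.
  by rewrite /j; case: arg_minnP.
have N0 (l : 'I_m) : (l < j)%N -> N r l = 0.
  by move=> lj; apply/eqP; apply: contraLR lj => /jmin; rewrite -leqNgt.
pose a : K := N r j.
(* Right multiplication by R adds u l times column j to column l. These values turn the pivot a into
   1 and clear the rest of row r; they vanish for l < j because the pivot is leftmost, so R is upper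
   triangular. *)
pose u (l : 'I_m) : K := if l == j then a^-1 - 1 else - (N r l / a).
pose R : 'M[K]_m := \matrix_(i, l) ((i == l)%:R + (i == j)%:R * u l).
have Rb : borel R.
  have tr : is_trig_mx R^T.
    apply/is_trig_mxP => l i li; rewrite !mxE [i == l]eq_sym.
    rewrite (ord_lt_eqF li) add0r.
    case: eqP => [ij|_]; last by rewrite mul0r.
    rewrite /u; case: eqP => [lj|_]; first by rewrite ij lj ltnn in li.
    by rewrite N0 ?mul0r ?oppr0 ?mulr0 // -ij.
  split => //; rewrite -unitmx_tr unitmxE (det_trig tr).
  apply: rpred_prod => i _; rewrite unitfE !mxE eqxx /u.
  case: (i =P j) => _; last by rewrite mul0r addr0 oner_neq0.
  by rewrite mul1r addrC subrK invr_eq0.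
have NRE i l : (N *m R) i l = N i l + N i j * u l.
  rewrite mxE (eq_bigr (fun h => N i h * (h == l)%:R + N i h * (h == j)%:R * u l)).
    rewrite big_split /=; congr (_ + _).
      rewrite (bigD1 l) //= eqxx mulr1 big1 ?addr0 // => h hl.
      by rewrite (negPf hl) mulr0.
    rewrite (bigD1 j) //= eqxx mulr1 big1 ?addr0 // => h hl.
    by rewrite (negPf hl) mulr0 mul0r.
  by move=> h _; rewrite mxE mulrDr mulrA.
(* Left multiplication by L adds c i times row r to row i. Row r of N R is already e_j, so only
   column j changes, and it becomes e_r. *)
pose c (i : 'I_m) : K := (i == r)%:R - (N *m R) i j.
pose L : 'M[K]_m := \matrix_(i, l) ((i == l)%:R + c i * (l == r)%:R).
have NRr l : (N *m R) r l = (l == j)%:R.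
  rewrite NRE -/a /u; case: eqP => [->|_].
    by rewrite mulrBr divff // mulr1 addrC subrK.
  by rewrite mulrN mulrCA divff // mulr1 subrr.
(* If an earlier row had its pivot in column j, that column would vanish in row r, contrary to the
   choice of j. Hence c vanishes above row r, and L is lower triangular. *)
have Nij (i : 'I_m) : (i < r)%N -> N i j = 0.
  move=> ir; have [h [Nih Nhi]] := piv i ir.
  rewrite Nih; case: eqP => // jh.
  move: jP; rewrite jh Nhi; case: (r =P i) => [ri|_]; last by rewrite mulr0n eqxx.
  by rewrite ri ltnn in ir.
have c0 (i : 'I_m) : (i <= r)%N -> c i = 0.
  rewrite leq_eqVlt /c => /orP[/eqP ir|ir].
    by rewrite (val_inj ir) NRr !eqxx subrr.
  by rewrite NRE Nij // mul0r addr0 (ord_lt_eqF ir) subrr.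
have Lb : opp_borel L.
  have tr : is_trig_mx L.
    apply/is_trig_mxP => i l il; rewrite mxE (ord_lt_eqF il) add0r.
    case: eqP => [lr|_]; last by rewrite mulr0.
    by rewrite c0 ?mul0r // -lr ltnW.
  split => //; rewrite unitmxE (det_trig tr).
  apply: rpred_prod => i _; rewrite unitfE !mxE eqxx.
  case: (i =P r) => [->|_]; first by rewrite c0 // mul0r addr0 oner_neq0.
  by rewrite mulr0 addr0 oner_neq0.
have LNRE i l : (L *m (N *m R)) i l = (N *m R) i l + c i * (l == j)%:R.
  rewrite mxE (eq_bigr (fun h => (i == h)%:R * (N *m R) h l +
    c i * ((h == r)%:R * (N *m R) h l))).
    rewrite big_split /=; congr (_ + _).
      rewrite (bigD1 i) //= eqxx mul1r big1 ?addr0 // => h hi.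
      by rewrite eq_sym (negPf hi) mul0r.
    rewrite -mulr_sumr (bigD1 r) //= eqxx mul1r big1 ?addr0 ?NRr // => h hr.
    by rewrite (negPf hr) mul0r.
  by move=> h _; rewrite mxE mulrDl mulrA.
exists (L *m (N *m R)).
  by apply: dcoset_trans MN _; exists L, R; split=> //; rewrite mulmxA.
move=> i; rewrite ltnS leq_eqVlt => /orP[/eqP ir|ir].
  have -> : i = r by exact: val_inj.
  exists j; split => l; rewrite LNRE; first by rewrite c0 // mul0r addr0 NRr.
  by rewrite eqxx mulr1 /c addrC subrK.
have [h [Nih Nhi]] := piv i ir.
have hj : h != j.
  apply: contraTneq ir => hj; move: jP; rewrite -hj Nhi.
  by case: (r =P i) => [<-|_]; rewrite ?ltnn // mulr0n eqxx.
exists h; split => l; rewrite LNRE NRE.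
  by rewrite c0 ?(ltnW ir) // mul0r addr0 Nij // mul0r addr0.
(* An earlier pivot column h is zero in row r, so u h = 0 and the column is unchanged. *)
rewrite (negPf hj) mulr0 addr0 Nhi /u (negPf hj) Nhi.
by rewrite [r == i]eq_sym (@ord_lt_eqF i r ir) mul0r oppr0 mulr0 addr0.
Qed.

Lemma bruhat_exists M : M \in unitmx -> exists s, dcoset M (perm_mx s).
Proof.
move=> Mu; have [N MN piv] := bruhat_elim Mu (leqnn m).
have [f fP] := choice (fun i => piv i (ltn_ord i)).
(* If rows i and i' share a pivot column, that column is e_i' and has a 1 in row i, so i = i'. *)
have f_inj : injective f.
  move=> i i' e; have [Ni _] := fP i; have [_ N'] := fP i'.
  apply/eqP; have := N' i; rewrite -e Ni eqxx; case: eqP => // _ /eqP.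
  by rewrite oner_eq0.
exists (perm f_inj); rewrite (_ : perm_mx _ = N) //.
apply/matrixP => i j; have [-> _] := fP i.
by rewrite !mxE permE eq_sym.
Qed.

(** Existence comes from elimination and keeps [xget] from returning its default; uniqueness holds
    because corner dimensions are constant on the double coset and separate permutations. *)
Lemma bruhat_permP M s : M \in unitmx ->
  dcoset M (perm_mx s) <-> s = bruhat_perm (dcoset M).
Proof.
move=> /bruhat_exists[s0 Ms0].
have Ms1 : dcoset M (perm_mx (bruhat_perm (dcoset M))).
  exact: (@xgetI _ 1%g [set s | dcoset M (perm_mx s)]%classic _ Ms0).
split=> [Ms|-> //]; apply: corner_dim_perm_inj => p q _ _.
by rewrite (corner_dim_dcoset p q Ms) (corner_dim_dcoset p q Ms1).
Qed.

Lemma bruhat_perm_eq M N : M \in unitmx -> N \in unitmx ->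
  bruhat_perm (dcoset M) = bruhat_perm (dcoset N) <->
  (forall p q, (p <= m)%N -> (q <= m)%N -> corner_dim M p q = corner_dim N p q).
Proof.
move=> Mu Nu.
have Ms := (bruhat_permP _ Mu).2 erefl; have Ns := (bruhat_permP _ Nu).2 erefl.
split=> [e p q _ _|e].
  by rewrite -(corner_dim_dcoset p q Ms) e (corner_dim_dcoset p q Ns).
apply: corner_dim_perm_inj => p q pm qm.
by rewrite (corner_dim_dcoset p q Ms) e // (corner_dim_dcoset p q Ns).
Qed.

End Bruhat.

(** * Rank-nullity for maps restricted to subspaces and projected to quotients *)

Section LinearRanks.
Variables (K : fieldType) (V V' : vectType K).
Implicit Types (U : {vspace V}) (W : {vspace V'}).

Lemma lrank_quot_proj (f : 'Hom(V, V')) W :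
  (\dim (f @^-1: W) + lrank (quot_proj W \o f)%VF = \dim {:V})%N.
Proof.
rewrite /lrank -(limg_ker_dim (quot_proj W \o f)%VF fullv) capfv.
congr (\dim _ + _)%N; apply/vspaceP => u.
by rewrite memv_ker comp_lfunE -memv_ker lker_quot_proj memv_preim.
Qed.

Lemma lrank_incl (Z : vectType K) (f : 'Hom(V, Z)) U :
  lrank (f \o incl U)%VF = \dim (f @: U).
Proof.
rewrite /lrank limg_comp; congr (\dim (_ @: _)); apply/vspaceP => u.
apply/memv_imgP/idP => [[w _ ->]|uU]; first by rewrite lfunE subvsP.
by exists (vsproj U u); rewrite ?memvf // lfunE /= vsprojK.
Qed.

Lemma lrank_quot_incl (f : 'Hom(V, V')) U W :
  (\dim (U :&: f @^-1: W) + lrank (quot_proj W \o (f \o incl U))%VF = \dim U)%N.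
Proof.
rewrite comp_lfunA lrank_incl -(limg_ker_dim (quot_proj W \o f)%VF U).
congr (\dim (_ :&: _) + _)%N; apply/vspaceP => u.
by rewrite memv_ker comp_lfunE -memv_ker lker_quot_proj memv_preim.
Qed.

End LinearRanks.

(** * The block matrix, its dependence on the lift, and its corners *)

Section BlockMatrix.
Variables (K : fieldType) (n : nat).
Implicit Types (X g b : 'M[K]_n) (F : flag K n).

Lemma w0_mulE p (A : 'M[K]_(n, p)) i j : (w0 K n *m A) i j = A (rev_ord i) j.
Proof.
rewrite mxE (bigD1 (rev_ord i)) //= mxE eqxx mul1r big1 ?addr0 // => k kr.
by rewrite mxE (negPf kr) mul0r.
Qed.

Lemma mul_w0E p (A : 'M[K]_(p, n)) i j : (A *m w0 K n) i j = A i (rev_ord j).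
Proof.
rewrite mxE (bigD1 (rev_ord j)) //= mxE rev_ordK eqxx mulr1 big1 ?addr0 // => k kr.
rewrite mxE; case: eqP => [jk|_]; last by rewrite mulr0.
by rewrite jk rev_ordK eqxx in kr.
Qed.

Lemma w0K : w0 K n *m w0 K n = 1%:M.
Proof. by apply/matrixP => i j; rewrite w0_mulE !mxE rev_ordK eq_sym. Qed.

Lemma w0_unit : w0 K n \in unitmx.
Proof. by case/mulmx1_unit: w0K. Qed.

(** Conjugation by w0 reverses the order of both rows and columns, which exchanges upper and lower
    triangular matrices. *)
Lemma w0_conj_borel b : borel b -> opp_borel (w0 K n *m b *m w0 K n).
Proof.
move=> bb; split; first by rewrite !unitmx_mul w0_unit; case: bb => ->.
apply/is_trig_mxP => i j ij; rewrite mul_w0E w0_mulE (borel_entry bb) //=.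
by have := ltn_ord j; lia.
Qed.

Lemma vmx_unit g X : g \in unitmx -> vmx g X \in unitmx.
Proof.
move=> gu; suff /mulmx1_unit[] : vmx g X *m
  block_mx 0 (g *m w0 K n) (invmx g) (- (invmx g *m X *m g *m w0 K n)) = 1%:M by [].
rewrite mulmx_block !mulmx0 !mul0mx !addr0 !add0r mulmxV // mulmxN !mulmxA.
rewrite mulmxV // mul1mx subrr mulmxKV // w0K.
by rewrite -scalar_mx_block.
Qed.

Lemma vmx_mulr_borel g X b : g \in unitmx -> borel b ->
  dcoset (vmx g X) (vmx (g *m b) X).
Proof.
move=> gu bb; have [bu bt] := bb; have [cu ct] := w0_conj_borel (borelV bb).
(* The right factor diag(1, b) turns g into g b; the left factor turns w0 g^-1 into w0 b^-1 g^-1,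
   and its lower block is lower triangular, being a conjugate of b^-1 by w0. *)
exists (block_mx 1%:M 0 0 (w0 K n *m invmx b *m w0 K n)), (block_mx 1%:M 0 0 b).
split.
- split; first by rewrite unitmxE det_ublock unitrM -!unitmxE unitmx1.
  by rewrite /= is_trig_block_mx ?eqxx ?scalar_mx_is_trig.
- split; first by rewrite unitmxE det_ublock unitrM -!unitmxE unitmx1.
  by rewrite /= tr_block_mx trmx1 !trmx0 is_trig_block_mx ?eqxx ?scalar_mx_is_trig.
rewrite /vmx !mulmx_block !mulmx0 !mul0mx !mulmx1 !mul1mx !addr0 !add0r mul0mx.
rewrite -[w0 K n *m invmx b *m w0 K n *m _]mulmxA (mulmxA (w0 K n) (w0 K n)).
rewrite w0K mul1mx; congr (block_mx _ _ _ _).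
have gbu : g *m b \in unitmx by rewrite unitmx_mul gu.
rewrite -mulmxA -[invmx b *m _](mulKmx gbu) !mulmxA.
by rewrite !mulmxK.
Qed.

Lemma col_spanE g j :
  col_span g j = (lmx g @: coord_space K (fun k : 'I_n => k < j)%N)%VS.
Proof.
rewrite limg_sum; apply: eq_bigr => k _; rewrite limg_line lmxE.
by rewrite colE.
Qed.

Lemma mem_col_span g j u : g \in unitmx ->
  (u \in col_span g j) = (invmx g *m u \in coord_space K (fun k : 'I_n => k < j)%N).
Proof.
move=> gu; rewrite col_spanE; apply/memv_imgP/idP => [[w wE ->]|uE].
  by rewrite lmxE mulKmx.
by exists (invmx g *m u); rewrite // lmxE mulKVmx.
Qed.

Lemma flag_at_dim F j : (j <= n)%N -> \dim (flag_at F j) = j.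
Proof. by move=> jn; rewrite flag_dim inordK. Qed.

(** Column k of h lies in F^(k+1), the span of the first k + 1 columns of g (k counted from 0), so
    its coordinates in the basis g vanish below the diagonal. *)
Lemma lift_borel F g h : is_lift F g -> is_lift F h ->
  exists2 b, borel b & h = g *m b.
Proof.
move=> [gu gF] [hu hF]; exists (invmx g *m h); last by rewrite mulKVmx.
split; first by rewrite unitmx_mul unitmx_inv gu.
apply/is_trig_mxP => k i ki; rewrite mxE.
have : col k h \in col_span g k.+1.
  rewrite -gF // hF // col_spanE; apply/memv_imgP; exists (delta_mx k 0).
    by apply: delta_coord_space; rewrite /= ltnS.
  by rewrite lmxE colE.
rewrite mem_col_span // => /coord_spaceP/(_ i).
by rewrite -leqNgt ki => /(_ isT); rewrite colE mulmxA -colE mxE.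
Qed.

Lemma flag_liftP F : is_lift F (flag_lift F).
Proof. exact: (svalP (cid (is_lift_exists F))). Qed.
Lemma anti_flagE p :
  anti_flag K n (n - p) = coord_space K (fun k : 'I_n => p <= k)%N.
Proof. by apply: eq_bigl => k; have := ltn_ord k; lia. Qed.

(** The truncated q - n covers both ranges: for q <= n it forces the lower half to vanish, and for q
    >= n the condition on the upper half is void. *)
Lemma mem_coord_space_lt (w : 'cV[K]_(n + n)) q :
  (w \in coord_space K (fun k : 'I_(n + n) => k < q)%N) =
  (usubmx w \in std_flag K n q) && (dsubmx w \in std_flag K n (q - n)).
Proof.
apply/coord_spaceP/andP => [w0|[/coord_spaceP u0 /coord_spaceP d0] k].
  split; apply/coord_spaceP => k nk; rewrite mxE w0 //=.
  by move: nk; lia.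
rewrite -[w]vsubmxK -leqNgt; case: (split_ordP k) => l -> /= ql.
  by rewrite col_mxEu u0 // -leqNgt.
by rewrite col_mxEd d0 // -leqNgt; lia.
Qed.

(** The lower half of the product is w0 g^-1 u, with u the upper half of w. As w0 reverses
    coordinates, the vanishing of its first p - n entries says that g^-1 u has only its first 2n - p
    coordinates; for p <= n this is void. *)
Lemma mem_vmx_coord_space_ge g X (w : 'cV[K]_(n + n)) p : g \in unitmx ->
  (vmx g X *m w \in coord_space K (fun k : 'I_(n + n) => p <= k)%N) =
  (X *m usubmx w + g *m dsubmx w \in anti_flag K n (n - p))
  && (usubmx w \in col_span g (n + n - p)).
Proof.
move=> gu; rewrite mem_col_span // anti_flagE -[w in LHS]vsubmxK mul_block_col.
rewrite mul0mx addr0 -mulmxA.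
set x := _ + _; set y := invmx g *m _.
apply/coord_spaceP/andP => [xy0|[/coord_spaceP x0 /coord_spaceP y0] k].
  split; apply/coord_spaceP => k nk.
    by rewrite -(col_mxEu x (w0 K n *m y)) xy0.
  rewrite -[k]rev_ordK -w0_mulE -(col_mxEd x) xy0 //=.
  by have := ltn_ord k; lia.
case: (split_ordP k) => l -> /= nl; first by rewrite col_mxEu x0.
by rewrite col_mxEd w0_mulE y0 //=; have := ltn_ord l; lia.
Qed.

(* Splitting w in the corner as (u, c), the first summand counts the possible
   u, and the second the c that go with u = 0. *)
Lemma corner_dim_vmx g X p q : g \in unitmx ->
  corner_dim (vmx g X) p q =
  (\dim (std_flag K n q :&: col_span g (n + n - p) :&:
     lmx X @^-1: (anti_flag K n (n - p) + col_span g (q - n))) +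
   \dim (anti_flag K n (n - p) :&: col_span g (q - n)))%N.
Proof.
move=> gu; rewrite /corner_dim; set C := (_ :&: _)%VS.
pose up : 'Hom('cV[K]_(n + n), 'cV[K]_n) := linfun usubmx.
pose dn : 'Hom('cV[K]_(n + n), 'cV[K]_n) := (lmx g \o linfun dsubmx)%VF.
have upE w : up w = usubmx w by rewrite lfunE.
have dnE w : dn w = g *m dsubmx w by rewrite comp_lfunE lmxE lfunE.
have CE w : (w \in C) = [&& usubmx w \in std_flag K n q,
    dsubmx w \in std_flag K n (q - n),
    X *m usubmx w + g *m dsubmx w \in anti_flag K n (n - p) &
    usubmx w \in col_span g (n + n - p)].
  by rewrite memv_cap -memv_preim lmxE mem_vmx_coord_space_ge //
    mem_coord_space_lt -andbA.
have gE c j : (g *m c \in col_span g j) = (c \in std_flag K n j).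
  by rewrite mem_col_span // mulKmx.
(* Rank-nullity for the projection w = (u, c) to u, restricted to the corner space C. *)
rewrite -(limg_ker_dim up C) addnC; congr (_ + _)%N.
  congr (\dim _); apply/vspaceP => u; apply/memv_imgP/idP => [[w wC ->]|].
    move: wC; rewrite CE upE => /and4P[uE cE xT uG].
    rewrite !memv_cap uE uG -memv_preim lmxE /=.
    apply/memv_addP; exists (X *m usubmx w + g *m dsubmx w) => //.
    exists (- (g *m dsubmx w)); last by rewrite addrK.
    by rewrite memvN gE.
  rewrite !memv_cap -memv_preim lmxE => /andP[/andP[uE uG]] /memv_addP[t tT [y yG Xu]].
  (* Writing X u = t + y with y in the span of the columns of g, the choice c = - g^-1 y leaves X u
     + g c = t. *)
  exists (col_mx u (- (invmx g *m y))); last by rewrite upE col_mxKu.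
  rewrite CE col_mxKu col_mxKd uE uG memvN -mem_col_span // yG mulmxN mulKVmx //.
  by rewrite Xu addrK tT.
(* On the kernel of [up] the map w = (0, c) to g c is injective, and its image is the intersection
   in the second summand. *)
rewrite -(@limg_dim_eq _ _ _ dn) => [|].
  congr (\dim _); apply/vspaceP => y; apply/memv_imgP/idP => [[w]|].
    rewrite memv_cap memv_ker CE upE dnE => /andP[/and4P[_ cE xT _]] /eqP u0 ->.
    rewrite memv_cap gE cE andbT.
    by move: xT; rewrite u0 mulmx0 add0r.
  rewrite memv_cap => /andP[yT yG].
  exists (col_mx 0 (invmx g *m y)); last first.
    by rewrite dnE col_mxKd mulKVmx.
  rewrite memv_cap memv_ker CE upE col_mxKu col_mxKd !mem0v eqxx.
  by rewrite -mem_col_span // yG mulmx0 add0r mulKVmx // yT.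
apply/eqP; rewrite -subv0; apply/subvP => w.
rewrite !memv_cap !memv_ker upE dnE => /andP[/andP[_ /eqP u0] /eqP gd0].
rewrite memv0 -[w]vsubmxK u0.
by rewrite -(mulKmx gu (dsubmx w)) gd0 mulmx0 col_mx0.
Qed.

Lemma std_flag_full i : (n <= i)%N -> std_flag K n i = fullv.
Proof.
move=> ni; apply/vspaceP => u; rewrite memvf; apply/coord_spaceP => k.
by rewrite (leq_trans (ltn_ord k) ni).
Qed.

Lemma col_span_full g i : g \in unitmx -> (n <= i)%N ->
  col_span g i = fullv.
Proof.
move=> gu ni; apply/vspaceP => u; rewrite mem_col_span // memvf.
by rewrite [coord_space _ _]std_flag_full ?memvf.
Qed.

Lemma col_span0 g : col_span g 0 = 0%VS.
Proof. by rewrite /col_span big_pred0. Qed.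

Lemma anti_flag0 : anti_flag K n 0 = 0%VS.
Proof. by rewrite /anti_flag big_pred0 // => k; have := ltn_ord k; lia. Qed.

End BlockMatrix.

(** * The four families of statistics as corner dimensions *)

Section Statistics.
Variables (K : fieldType) (n : nat) (F : flag K n) (X : 'M[K]_n).
Local Notation M := (vmx (flag_lift F) X).

Lemma flag_atE j : (j <= n)%N -> flag_at F j = col_span (flag_lift F) j.
Proof. by case: (flag_liftP F) => _; apply. Qed.

Lemma lift_unit : flag_lift F \in unitmx.
Proof. by case: (flag_liftP F). Qed.

Lemma stat_aE i j : (i <= n)%N -> (j <= n)%N ->
  (corner_dim M (n - j) i + stat_a X i j = \dim (std_flag K n i))%N.
Proof.
move=> li lj; rewrite corner_dim_vmx ?lift_unit //.
have -> : (i - n = 0)%N by lia.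
have -> : (n - (n - j) = j)%N by lia.
rewrite col_span0 addv0 capv0 dimv0 addn0 [col_span _ _]col_span_full ?lift_unit //.
  by rewrite capvf lrank_quot_incl.
by lia.
Qed.

(** Here u ranges over the whole space, so the first summand of [corner_dim_vmx] is n minus the
    rank, while the second is the dimension subtracted in (b). *)
Lemma stat_bE i j : (i <= n)%N -> (j <= n)%N ->
  stat_b F X i j = n%:Z - (corner_dim M i (n + j))%:Z.
Proof.
move=> li lj; rewrite corner_dim_vmx ?lift_unit //.
have := lrank_quot_proj (lmx X) (anti_flag K n (n - i) + flag_at F j)%VS.
rewrite dim_cV /stat_b addKn flag_atE // std_flag_full ?leq_addr //.
rewrite [col_span _ (n + n - i)]col_span_full ?lift_unit //; last by lia.
rewrite capfv capfv.
set r := lrank _; set k := \dim (lmx X @^-1: _); set c := \dim (_ :&: _).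
by move: r k c => r k c; lia.
Qed.

(** Both E_(n-p) and F^(q-n) are zero here, so the corner dimension is that of the kernel of X on
    the intersection of E^j and F^(n-i). *)
Lemma stat_cE i j : (i <= n)%N -> (j <= n)%N ->
  stat_c F X i j = - (corner_dim M (n + i) j)%:Z.
Proof.
move=> li lj; rewrite corner_dim_vmx ?lift_unit // /stat_c lrank_incl.
have -> : (n + n - (n + i) = n - i)%N by lia.
have -> : (n - (n + i) = 0)%N by lia.
have -> : (j - n = 0)%N by lia.
rewrite col_span0 anti_flag0 addv0 capv0 dimv0 addn0 lpreim0.
rewrite -flag_atE ?leq_subr // [(flag_at _ _ :&: _)%VS]capvC.
have := limg_ker_dim (lmx X) (std_flag K n j :&: flag_at F (n - i))%VS.
set r := \dim (_ @: _); set k := \dim (_ :&: lker _); set c := \dim (_ :&: _).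
by move: r k c => r k c; lia.
Qed.

Lemma stat_dE i j : (i <= n)%N -> (j <= n)%N ->
  (corner_dim M (n + n - i) (n + j) + stat_d F X i j = i)%N.
Proof.
move=> li lj; rewrite corner_dim_vmx ?lift_unit //.
have -> : (n + n - (n + n - i) = i)%N by lia.
have -> : (n - (n + n - i) = 0)%N by lia.
rewrite addKn anti_flag0 add0v cap0v dimv0 addn0 std_flag_full ?leq_addr //.
by rewrite capfv -!flag_atE // lrank_quot_incl flag_at_dim.
Qed.

(** Rows p = 2n would correspond to i = 0 in (d), outside the range of that statistic. *)
Lemma corner_dim_last q : (n < q)%N -> corner_dim M (n + n) q = 0%N.
Proof.
move=> nq; rewrite corner_dim_vmx ?lift_unit // subnn.
have -> : (n - (n + n) = 0)%N by lia.
by rewrite col_span0 anti_flag0 capv0 cap0v cap0v dimv0.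
Qed.

End Statistics.

Theorem proposition1p1 (K : fieldType) (n : nat) :
  [/\ (* independence of the representative of gB, and of the lift of a flag *)
      forall X g b : 'M[K]_n, g \in unitmx -> borel b ->
        vmx g X \in unitmx /\ dcoset (vmx (g *m b) X) = dcoset (vmx g X),
      forall (F : flag K n) (X g : 'M[K]_n), is_lift F g ->
        v_dcoset F X = dcoset (vmx g X),
      (* v F X is the only permutation whose matrix lies in the double coset *)
      forall (F : flag K n) (X : 'M[K]_n) (s : 'S_(n + n)),
        v_dcoset F X (perm_mx s) <-> s = v F X
    & forall (F F' : flag K n) (X X' : 'M[K]_n),
        v F X = v F' X' <->
        [/\ forall i j : nat, (1 <= i <= n)%N -> (j < n)%N ->
              stat_a X i j = stat_a X' i j,
            forall i j : nat, (1 <= i <= n)%N -> (1 <= j <= n)%N ->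
              stat_b F X i j = stat_b F' X' i j,
            forall i j : nat, (1 <= i <= n)%N -> (1 <= j <= n)%N ->
              stat_c F X i j = stat_c F' X' i j
          & forall i j : nat, (1 <= i <= n)%N -> (1 <= j <= n)%N ->
              stat_d F X i j = stat_d F' X' i j]].
Proof.
split.
- move=> X g b gu bb; split; first exact: vmx_unit.
  exact/dcoset_eq/vmx_mulr_borel.
- move=> F X g gF; have [b bb ->] := lift_borel (flag_liftP F) gF.
  by rewrite /v_dcoset (dcoset_eq (vmx_mulr_borel X (lift_unit F) bb)).
- by move=> F X s; exact: bruhat_permP (vmx_unit X (lift_unit F)).
move=> F F' X X'; rewrite /v /v_dcoset.
set M := vmx _ X; set M' := vmx _ X'.
apply: (iff_trans (bruhat_perm_eq (vmx_unit _ (lift_unit F))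
                                  (vmx_unit _ (lift_unit F')))).
rewrite -/M -/M'; split=> [MM'|[Ha Hb Hc Hd] p q pn qn].
  split=> i j li lj.
  - have := @stat_aE K n F X i j; have := @stat_aE K n F' X' i j.
    by rewrite -/M -/M' -MM'; lia.
  - by rewrite !stat_bE -/M -/M' ?MM' //; lia.
  - by rewrite !stat_cE -/M -/M' ?MM' //; lia.
  - have := @stat_dE K n F X i j; have := @stat_dE K n F' X' i j.
    by rewrite -/M -/M' -MM'; lia.
have [->|p0] := posnP p; first by rewrite !corner_dim0p.
have [->|q0] := posnP q; first by rewrite !corner_dimp0.
(* The four positions of (p, q) relative to n select (a) at (q, n - p), (b) at (p, q - n), (c) at (p
   - n, q) and (d) at (2n - p, q - n). *)
have [lp|lp] := leqP p n; have [lq|lq] := leqP q n.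
- have := @stat_aE K n F X q (n - p); have := @stat_aE K n F' X' q (n - p).
  rewrite -/M -/M' Ha ?subKn //; by lia.
- have := Hb p (q - n)%N; rewrite !stat_bE -/M -/M' ?subnKC ?(ltnW lq) //; by lia.
- have := Hc (p - n)%N q; rewrite !stat_cE -/M -/M' ?subnKC ?(ltnW lp) //; by lia.
have [p2|p2] := eqVneq p (n + n)%N; first by rewrite p2 !corner_dim_last.
have := @stat_dE K n F X (n + n - p) (q - n).
have := @stat_dE K n F' X' (n + n - p) (q - n).
rewrite -/M -/M' Hd ?subnKC ?(ltnW lq) ?subKn //; by lia.
Qed.
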